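(* Let $N=4m+2\ge6$ and $\vartheta\in\mathbb R$. Define $$d_N(\vartheta):=\operatorname{dist}\Bigl(\vartheta,\frac{2\pi}{N}\mathbb Z\Bigr)\in[0,\pi/N],\qquad \gamma_N(\vartheta):=\frac12\sqrt{\sin d_N(\vartheta)\,\sin\Bigl(\frac{2\pi}{N}-d_N(\vartheta)\Bigr)}.$$ Then every $z\in\operatorname{spec}A_N(\pi/2,\vartheta)$ satisfies $$|\operatorname{Re} z^2|\le\gamma_N(\vartheta)\le\frac12\sin\frac{\pi}{N}.$$ Consequently, $$\operatorname{dist}(z,\mathcal X_{\pi/4})\le\sqrt{\frac{\gamma_N(\vartheta)}2}\le\frac12\sqrt{\sin\frac{\pi}{N}},$$ and if $z\ne0$, also $$\operatorname{dist}(z,\mathcal X_{\pi/4})\le\frac{\gamma_N(\vartheta)}{\sqrt2\,|z|}\le\frac{\sin(\pi/N)}{2\sqrt2\,|z|}.$$ If $\vartheta\in\frac{2\pi}{N}\mathbb Z$, then $\operatorname{spec}A_N(\pi/2,\vartheta)\subset\mathcal X_{\pi/4}$. If $\vartheta\notin\frac{2\pi}{N}\mathbb Z$, then $\operatorname{spec}A_N(\pi/2,\vartheta)\cap\mathcal X_{\pi/4}=\varnothing$. More precisely, with the positive numbers $\tau_{1,N},\ldots,\tau_{m,N}$ such that $\det\bigl(zI-A_N(\pi/2,0)\bigr)=z^2\prod_{r=1}^m(z^4+\tau_{r,N})$, one has $$\det\bigl(zI-A_N(\pi/2,\vartheta)\bigr)=z^2\prod_{r=1}^m(z^4+\tau_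{r,N})+2^{1-N}\bigl(1-\cos(N\vartheta)\bigr).$$
   Context: Indices of $\mathbb C^N$ are in $\mathbb Z/N\mathbb Z$; $Se_j=e_{j+1}$ is the periodic shift and $$A_N(\varphi,\vartheta)=e^{i\varphi}\frac{S+S^{-1}}2+\operatorname{diag}\bigl(\cos(\tfrac{2\pi j}{N}+\vartheta)\bigr)_{j\in\mathbb Z/N\mathbb Z}.$$ $\mathcal X_{\pi/4}:=e^{i\pi/4}\mathbb R\cup e^{3i\pi/4}\mathbb R\subset\mathbb C$. The existence of positive $\tau_{r,N}$ (depending only on $N$) factoring the characteristic polynomial of $A_N(\pi/2,0)$ as stated, for $N=4m+2$, is a separate theorem of the paper. *)

(* Defs.v *)
From mathcomp Require Import all_boot all_order all_algebra.
From mathcomp Require Import complex.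
From mathcomp Require Import all_classical all_reals all_analysis.

Set Implicit Arguments.
Unset Strict Implicit.
Unset Printing Implicit Defensive.

Import Order.TTheory GRing.Theory Num.Theory.

Local Open Scope classical_set_scope.
Local Open Scope ring_scope.
Local Open Scope complex_scope.

Definition expi (R : realType) (t : R) : R[i] := cos t +i* sin t.

Definition dist (R : realType) (V : normedZmodType R) (x : V) (A : set V) : R :=
  inf [set `|x - y| | y in A].

(* [Rcomplex R] is [R[i]] with the modulus taken in [R] instead of [R[i]]. *)
Definition cabs (R : realType) (z : R[i]) : R := `|z : Rcomplex R|.

Definition cdist (R : realType) (z : R[i]) (A : set R[i]) : R :=
  dist (z : Rcomplex R) A.

(* [ordS j] is j + 1 modulo N; acting on columns, this sends e_j to e_(j+1). *)
Definition shift_mx (R : realType) (N : nat) : 'M[R[i]]_N :=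
  \matrix_(k, j) (k == ordS j)%:R.

Definition A_mx (R : realType) (N : nat) (phi theta : R) : 'M[R[i]]_N :=
  (expi phi / 2) *: (shift_mx R N + invmx (shift_mx R N))
  + diag_mx (\row_(j < N) (cos (2 * pi * j%:R / N%:R + theta))%:C).

Definition spec (R : realType) (N : nat) (M : 'M[R[i]]_N) : set R[i] :=
  [set z | eigenvalue M z].

Definition cross_pi4 (R : realType) : set R[i] :=
  [set expi (pi / 4) * t%:C | t in [set: R]]
  `|` [set expi (3 * pi / 4) * t%:C | t in [set: R]].

Definition lattice (R : realType) (N : nat) : set R :=
  [set 2 * pi / N%:R * k%:~R | k in [set: int]].

Arguments cross_pi4 R : clear implicits.
Arguments lattice R N : clear implicits.

Definition dN (R : realType) (N : nat) (theta : R) : R :=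
  dist theta (lattice R N).

Definition gammaN (R : realType) (N : nat) (theta : R) : R :=
  2^-1 * Num.sqrt (sin (dN N theta) * sin (2 * pi / N%:R - dN N theta)).

(* Main.v *)
(** Conjugation by the shift makes [det (z - A theta)] invariant under
    [theta -> theta + 2 pi / N], so as a Laurent polynomial in [exp (i theta)] it
    only contains the exponents 0 and [+-N] (Chambers' formula); this gives the
    determinant identity and lets one replace [theta] by [d = dN theta]. At
    [theta = 0] the Fourier transform exchanges the two parts of [A], whence
    [p (i z) = - p z] and [p] is purely imaginary on the cross.

    For the bound on [Re z^2], a chirped Fourier transform turns [A] into a
    periodic Jacobi matrix with zero diagonal whose link products are
    [i / 2 * cos (pi (2 k + 1) / N - d)]. With suitable positive weights it is, up
    to a phase, Hermitian on the half of the links where the cosine is positive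
    and anti-Hermitian on the other half, so only the two hops across the
    boundaries contribute to [Re z^2], each with amplitude [gammaN]. The weights
    degenerate at [d = 0], which is reached by a limit. *)

Require Import Defs.
From mathcomp Require Import all_boot all_order all_algebra.
From mathcomp Require Import complex.
From mathcomp Require Import all_classical all_reals all_analysis.
From mathcomp Require Import perm zify ring lra.

Set Implicit Arguments.
Unset Strict Implicit.
Unset Printing Implicit Defensive.

Import Order.TTheory GRing.Theory Num.Theory.

Local Open Scope classical_set_scope.
Local Open Scope ring_scope.
Local Open Scope complex_scope.

(** * Chambers' formula for circulant matrices *)

(** The rows and the columns undergo the same permutation, so its sign appears twice and cancels. *)
Lemma det_mxsub_inj (F : comNzRingType) (n : nat) (M : 'M[F]_n) (f : 'I_n -> 'I_n) :
  injective f -> \det (mxsub f f M) = \det M.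
Proof.
move=> fI; have -> : mxsub f f M = row_perm (perm fI) (col_perm (perm fI) M).
  by apply/matrixP => i j; rewrite !mxE !permE.
rewrite row_permE col_permE !det_mulmx !det_perm odd_permV mulrC -mulrA.
by rewrite -signr_addb addbb mulr1.
Qed.

(** In degree [d * size r] only the coefficients at [d] can meet. The bound need not be attained, so
    their product may vanish. *)
Lemma coef_prod_top (F : idomainType) (I : Type) (r : seq I) (f : I -> {poly F})
    (d : nat) : (forall i, (size (f i) <= d.+1)%N) ->
  (size (\prod_(i <- r) f i)%R <= (d * size r).+1)%N /\
  (\prod_(i <- r) f i)`_(d * size r) = \prod_(i <- r) (f i)`_d.
Proof.
move=> fd; elim: r => [|a r [IHs IHc]].
  by rewrite !big_nil muln0 size_poly1 coef1.
rewrite !big_cons /= mulnS; split.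
  apply: leq_trans (size_polyMleq _ _) _.
  rewrite -subn1 leq_subLR add1n -addSn -addnS.
  exact: leq_add.
rewrite coefM (bigD1 (inord d : 'I_(d + d * size r).+1)) //= inordK; last by rewrite ltnS leq_addr.
rewrite addKn IHc [X in _ + X]big1 ?addr0 // => j jd.
have {}jd : (j : nat) != d.
  by apply: contraNneq jd => jd; apply/eqP/val_inj; rewrite /= inordK ?ltnS ?leq_addr.
have [jlt|jge] := ltnP j d.
  rewrite [X in _ * X]nth_default ?mulr0 //; apply: leq_trans IHs _.
  by rewrite ltn_subRL ltn_add2r.
rewrite nth_default ?mul0r //; apply: leq_trans (fd a) _.
by rewrite ltn_neqAle eq_sym jd jge.
Qed.

Lemma det_coef_top (F : idomainType) (n d : nat) (M : 'M[{poly F}]_n) :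
  (forall i j, (size (M i j) <= d.+1)%N) ->
  (size (\det M) <= (d * n).+1)%N /\
  (\det M)`_(d * n) = \det (map_mx (fun p : {poly F} => p`_d) M).
Proof.
move=> Md.
have H (s : 'S_n) : (size (\prod_i M i (s i))%R <= (d * n).+1)%N /\
    (\prod_i M i (s i))`_(d * n) = \prod_i (M i (s i))`_d.
  have := coef_prod_top (index_enum 'I_n) (fun i => Md i (s i)).
  by rewrite -[index_enum _]enumT -cardT card_ord.
have szs (s : 'S_n) (p : {poly F}) : size ((-1) ^+ s * p) = size p.
  by case: (odd_perm s); rewrite ?expr1 ?expr0 ?mulN1r ?mul1r ?size_polyN.
split.
  apply: leq_trans (size_sum _ _ _) _; apply/bigmax_leqP => s _.
  by rewrite szs; have [] := H s.
rewrite coef_sum; apply: eq_bigr => s _.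
under [in RHS]eq_bigr do rewrite mxE.
rewrite -(H s).2.
by case: (odd_perm s); rewrite ?expr1 ?expr0 ?mulN1r ?mul1r ?coefN.
Qed.

Lemma coef_comp_scaleX (F : comNzRingType) (p : {poly F}) (w : F) (k : nat) :
  (p \Po (w *: 'X))`_k = p`_k * w ^+ k.
Proof.
rewrite comp_polyE coef_sum.
under eq_bigr do rewrite exprZn !coefZ coefXn.
rewrite -(big_mkord xpredT (fun i => p`_i * (w ^+ i * (k == i)%:R))).
have [lt|ge] := ltnP k (size p).
  rewrite (bigD1_seq k) ?iota_uniq ?mem_index_iota //= eqxx mulr1 big1 ?addr0 // => i.
  by rewrite eq_sym => /negbTE ->; rewrite !mulr0.
rewrite [p`_k]nth_default // mul0r big_nat big1 // => i /andP[_ il].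
by rewrite gtn_eqF ?mulr0 // (leq_trans il).
Qed.

(* Multiplied by [x ^+ n], the determinant is a polynomial in [x] of degree at
   most [2 n]; conjugation by the shift makes it invariant under [x -> w * x],
   so only the exponents 0, n and 2 n survive. *)
Lemma det_circulant_diag (F : fieldType) (n : nat) (K : 'M[F]_n) (w a : F) :
  n.-primitive_root w -> (forall i j, K (ordS i) (ordS j) = K i j) ->
  exists p1, forall x, x != 0 ->
    \det (K + diag_mx (\row_j (a * (w ^+ j * x + (w ^+ j * x)^-1)))) =
    p1 + a ^+ n * (\prod_(i < n) w ^+ i * x ^+ n
                   + (\prod_(i < n) w ^+ i * x ^+ n)^-1).
Proof.
move=> wn Kc; have n0 := prim_order_gt0 wn.
have w0 : w != 0.
  apply/eqP => w0; move: (prim_expr_order wn) => /eqP.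
  by rewrite w0 expr0n gtn_eqF // eq_sym oner_eq0.
pose M : 'M[{poly F}]_n := \matrix_(i, j) ((K i j)%:P * 'X +
   (a *+ (i == j))%:P * ((w ^+ i)%:P * 'X^2 + ((w ^+ i)^-1)%:P)).
have horM x : x != 0 -> (\det M).[x] =
    x ^+ n * \det (K + diag_mx (\row_j (a * (w ^+ j * x + (w ^+ j * x)^-1)))).
  move=> x0; rewrite -horner_evalE -det_map_mx -detZ; congr (\det _).
  apply/matrixP => i j; rewrite !mxE -[LHS]/(_.[_]) !hornerE.
  have [->|_] := eqVneq i j; last by rewrite !mulr0n mul0r !addr0 mulrC.
  by rewrite !mulr1n /=; field; rewrite x0 expf_neq0.
have sM i j : (size (M i j) <= 3)%N.
  rewrite mxE; apply: leq_trans (size_polyD _ _) _; rewrite geq_max.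
  rewrite mul_polyC (leq_trans (size_scale_leq _ _)) ?size_polyX //=.
  rewrite mul_polyC (leq_trans (size_scale_leq _ _)) //.
  apply: leq_trans (size_polyD _ _) _; rewrite geq_max mul_polyC.
  rewrite (leq_trans (size_scale_leq _ _)) ?size_polyXn //=.
  by rewrite (leq_trans (size_polyC_leq1 _)).
have [sP cP] := det_coef_top sM.
(* Shifting both indices turns [w ^+ i] into [w * w ^+ i]; the substitution differs from this by a
   factor [w] in each entry, hence by [w ^+ n = 1] in the determinant. *)
have inv : \det M \Po (w *: 'X) = \det M.
  rewrite -[LHS]/(comp_poly _ _) -det_map_mx.
  have -> : map_mx (comp_poly (w *: 'X)) M = w%:P *: mxsub (@ordS n) (@ordS n) M.
    apply/matrixP => i j; rewrite !mxE -[LHS]/(_ \Po _) Kc (inj_eq (@ordS_inj n)).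
    rewrite expr2 !(comp_polyD, comp_polyM, comp_polyC, comp_polyX).
    have -> : w ^+ ordS i = w * w ^+ i by rewrite /= (expr_mod _ (prim_expr_order wn)) exprS.
    have e : (w ^+ i)^-1 = w * (w * w ^+ i)^-1 by rewrite invfM mulrA divff ?mul1r.
    by rewrite {1}e -!mul_polyC !polyCM; ring.
  rewrite detZ det_mxsub_inj; last exact: ordS_inj.
  by rewrite -polyC_exp (prim_expr_order wn) mul1r.
have coef0 k : ~~ (n %| k)%N -> (\det M)`_k = 0.
  move=> nk; have /(congr1 (fun p : {poly F} => p`_k)) := inv.
  rewrite coef_comp_scaleX => /eqP; rewrite -subr_eq0 -[X in _ - X]mulr1.
  rewrite -mulrBr mulf_eq0 subr_eq0 -(prim_order_dvd wn) (negbTE nk) orbF.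
  by move/eqP.
have PE x : (\det M).[x] = (\det M)`_0 + (\det M)`_n * x ^+ n
                           + (\det M)`_(2 * n) * x ^+ (2 * n).
  rewrite (horner_coef_wide _ sP) big_ord_recr /=; congr (_ + _).
  rewrite -(big_mkord xpredT (fun i => (\det M)`_i * x ^+ i)).
  rewrite (@big_cat_nat _ _ _ n) //=; last by rewrite mulSn leq_addr.
  (* In a block of at most [n] indices starting at a multiple of [n], only the first is divisible by
     [n]; the top index [2 * n] has been split off. *)
  have e0 k l : (0 < l)%N -> (l <= n)%N ->
      \sum_(k * n <= i < k * n + l) (\det M)`_i * x ^+ i = (\det M)`_(k * n) * x ^+ (k * n).
    move=> l0 ln; rewrite big_ltn; last by lia.
    rewrite big_nat_cond big1 ?addr0 // => i /andP[/andP[i1 i2] _].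
    rewrite coef0 ?mul0r //; apply/negP => /dvdnP [q e].
    move: i1 i2; rewrite {}e ltn_pmul2r // => kq /leq_trans.
    move=> /(_ (k.+1 * n)%N); rewrite mulSnr leq_add2l => /(_ ln).
    by rewrite -mulSnr ltn_pmul2r // ltnS leqNgt kq.
  have s0 := e0 0%N n n0 (leqnn n); rewrite mul0n add0n expr0 mulr1 in s0.
  have s1 := e0 1%N n n0 (leqnn n); rewrite mul1n in s1.
  by rewrite mul2n -addnn s0 s1.
pose Q := \prod_(i < n) w ^+ i.
have Q0 : Q != 0 by apply/prodf_neq0 => i _; apply: expf_neq0.
(* [K] enters with degree 1 only, so both extreme coefficients are determinants of diagonal
   matrices. *)
have c2 : (\det M)`_(2 * n) = a ^+ n * Q.
  rewrite cP (_ : map_mx _ M = diag_mx (\row_j (a * w ^+ j))).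
    rewrite det_diag; under eq_bigr do rewrite mxE.
    by rewrite big_split /= prodr_const card_ord.
  apply/matrixP => i j; rewrite !mxE !(coefD, coefCM, coefX, coefXn, coefC) /=.
  have [->|_] := eqVneq i j; rewrite ?mulr1n ?mulr0n /=; ring.
have c0 : (\det M)`_0 = a ^+ n * Q^-1.
  rewrite -horner_coef0 -horner_evalE -det_map_mx.
  rewrite (_ : map_mx _ M = diag_mx (\row_j (a * (w ^+ j)^-1))).
    rewrite det_diag; under eq_bigr do rewrite mxE.
    by rewrite big_split /= prodr_const card_ord prodfV.
  apply/matrixP => i j; rewrite !mxE -[LHS]/(_.[_]) !hornerE.
  have [->|_] := eqVneq i j; rewrite ?mulr1n ?mulr0n /=; ring.
exists (\det M)`_n => x x0.
have xn0 : x ^+ n != 0 by apply: expf_neq0.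
apply: (mulfI xn0); rewrite -horM // PE c0 c2 -/Q mulnC exprM.
by field; rewrite Q0 xn0.
Qed.

(** * Roots of unity *)

Section expi.
Variable R : realType.
Implicit Types (x y t : R) (n : nat).

Lemma expiD x y : expi (x + y) = expi x * expi y.
Proof. by rewrite /expi cosD sinD; apply/eqP; rewrite eq_complex /= [sin x * _ + _]addrC !eqxx. Qed.

Lemma expi0 : expi (0 : R) = 1.
Proof. by rewrite /expi cos0 sin0. Qed.

Lemma expiN x : expi (- x) = (expi x)^-1.
Proof.
have e : expi (- x) * expi x = 1 by rewrite -expiD addNr expi0.
have x0 : expi x != 0.
  by apply/eqP => x0; move: e => /eqP; rewrite x0 mulr0 eq_sym (oner_eq0 R[i]).
by apply: (mulIf x0); rewrite e mulVf.
Qed.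

Lemma expi_neq0 x : expi x != 0.
Proof.
have e : expi (- x) * expi x = 1 by rewrite -expiD addNr expi0.
by apply/eqP => x0; move: e => /eqP; rewrite x0 mulr0 eq_sym (oner_eq0 R[i]).
Qed.

Lemma conjc_expi x : (expi x)^* = (expi x)^-1.
Proof. by rewrite -expiN /expi cosN sinN. Qed.

Lemma expiX x n : expi x ^+ n = expi (n%:R * x).
Proof.
elim: n => [|n IHn]; first by rewrite expr0 mul0r expi0.
by rewrite exprS IHn -expiD mulrSr mulrDl mul1r addrC.
Qed.

Lemma expi_pi : expi (pi : R) = -1.
Proof. by rewrite /expi cospi sinpi; apply/eqP; rewrite eq_complex /= oppr0 !eqxx. Qed.

Lemma expi_2pi : expi (2 * pi : R) = 1.
Proof. by rewrite mulrDl mul1r expiD expi_pi mulrNN mul1r. Qed.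

Lemma expiD_2pi x : expi (x + 2 * pi) = expi x.
Proof. by rewrite expiD expi_2pi mulr1. Qed.

Lemma expi_pihalf : expi (pi / 2 : R) = 'i.
Proof. by rewrite /expi cos_pihalf sin_pihalf. Qed.

Lemma cosC x : (cos x)%:C = (expi x + (expi x)^-1) / 2.
Proof.
rewrite -conjc_expi addcJ /= mulrC mulKf //.
Qed.

(** Half-angle formula: [1 - cos x] is twice the square of [sin (x / 2)], which is positive inside
    the interval. *)
Lemma cos_eq1 x : 0 <= x < 2 * pi -> cos x = 1 -> x = 0.
Proof.
move=> /andP[x0 x2] cx; apply/eqP; case: eqVneq => // xn0.
have s0 : 0 < sin (x / 2).
  apply: sin_gt0_pi; rewrite divr_gt0 ?ltr0n //=; last by rewrite lt_def xn0.
  by rewrite ltr_pdivrMr ?ltr0n // mulrC.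
have := cos_mulr2n (x / 2); rewrite (_ : (x / 2) *+ 2 = x); last by rewrite -mulr_natr divfK.
rewrite cos2sin2 cx.
by move=> e; have := exprn_gt0 2 s0; lra.
Qed.

Lemma expi_prim_root n : (0 < n)%N -> n.-primitive_root (expi (2 * pi / n%:R : R)).
Proof.
move=> n0; have n0' : (n%:R : R) != 0 by rewrite pnatr_eq0 -lt0n.
apply/andP; split=> //; apply/forallP => i; apply/eqP; rewrite unity_rootE expiX.
have [->|ne] := eqVneq i.+1 n.
  by rewrite mulrC divfK // expi_2pi eqxx.
apply/negbTE; apply/negP => /eqP /(congr1 (@complex.Re R)) /= c1.
have in_n : (i.+1 < n)%N by rewrite ltn_neqAle ne ltn_ord.
have /cos_eq1 := c1.
have pi0 := pi_gt0 R.
have n0r : 0 < (n%:R : R) by rewrite ltr0n.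
have le : 0 < i.+1%:R * (2 * (pi : R) / n%:R) < 2 * (pi : R).
  apply/andP; split; first by rewrite !mulr_gt0 ?invr_gt0 ?ltr0n.
  by rewrite mulrA ltr_pdivrMr // mulrC ltr_pM2l ?ltr_nat // mulr_gt0 ?ltr0n.
have /andP[le1 le2] := le.
by rewrite (ltW le1) le2 => /(_ isT) e; rewrite e ltxx in le1.
Qed.

End expi.

(** * The characteristic polynomial of [A] *)

Lemma det_similar (F : fieldType) (n : nat) (P M M' : 'M[F]_n) :
  \det P != 0 -> P *m M = M' *m P -> \det M = \det M'.
Proof.
move=> P0 e; apply: (mulfI P0).
by rewrite -det_mulmx e det_mulmx mulrC.
Qed.

Lemma horner_char_poly (F : comNzRingType) (n : nat) (M : 'M[F]_n) (z : F) :
  (char_poly M).[z] = \det (z%:M - M).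
Proof.
rewrite /char_poly -horner_evalE -det_map_mx; congr (\det _).
apply/matrixP => i j; rewrite !mxE -[LHS]/(_.[_]) !hornerE.
by case: (i == j); rewrite ?mulr1n ?mulr0n !hornerE.
Qed.

(** Once the Fourier transform has exchanged [X] and [Y], this restores the original form at the
    rotated point [- 'i * z]. *)
Lemma mx_quarter_turn (R : realType) (n : nat) (z : R[i]) (X Y : 'M[R[i]]_n) :
  z%:M - X - 'i *: Y = 'i *: ((- 'i * z)%:M - Y + 'i *: X).
Proof.
have ii : 'i * 'i = -1 :> R[i] by rewrite -expr2 sqr_i.
have iz : 'i * (- 'i * z) = z by rewrite mulrA mulrN ii opprK mul1r.
by rewrite scalerDr scalerBr scale_scalar_mx scalerA ii scaleN1r iz addrAC.
Qed.

Section Matrices.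
Variables (R : realType) (N : nat).

Local Notation S := (shift_mx R N).
Local Notation w := (expi (2 * pi / N%:R : R)).
Let C := 2^-1 *: (S + S^T).
Let D theta : 'M[R[i]]_N :=
  diag_mx (\row_(j < N) (cos (2 * pi * j%:R / N%:R + theta))%:C).

Lemma invmx_shift : invmx S = S^T.
Proof.
have e : S^T *m S = 1%:M.
  apply/matrixP => i j; rewrite !mxE (bigD1 (ordS i)) //= !mxE eqxx mul1r.
  rewrite big1 ?addr0 ?(inj_eq (@ordS_inj N)) // => k ki.
  by rewrite !mxE (negbTE ki) mul0r.
have [_ uS] := mulmx1_unit e.
by rewrite -[RHS]mulmx1 -(mulmxV uS) mulmxA e mul1mx.
Qed.

Lemma A_mx_pihalf theta : A_mx N (pi / 2) theta = D theta + 'i *: C.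
Proof.
by rewrite /A_mx expi_pihalf invmx_shift addrC /C scalerA.
Qed.

Definition detA (theta : R) (z : R[i]) : R[i] :=
  \det (z%:M - A_mx N (pi / 2) theta).

Lemma specE theta z : spec (A_mx N (pi / 2) theta) z <-> detA theta z = 0.
Proof.
rewrite /spec /= eigenvalue_root_char /root horner_char_poly.
by split => /eqP.
Qed.

Lemma mxCE i j : C i j = ((i == ordS j)%:R + (j == ordS i)%:R) / 2.
Proof. by rewrite !mxE mulrC. Qed.

Lemma mul_mx_shift m (X : 'M[R[i]]_(m, N)) i j : (X *m S) i j = X i (ordS j).
Proof.
rewrite mxE (bigD1 (ordS j)) //= mxE eqxx mulr1 big1 ?addr0 // => k kj.
by rewrite mxE (negbTE kj) mulr0.
Qed.

Lemma mul_mx_shiftT m (X : 'M[R[i]]_(m, N)) i j :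
  (X *m S^T) i j = X i (ord_pred j).
Proof.
rewrite mxE (bigD1 (ord_pred j)) //= !mxE ord_predK eqxx mulr1 big1 ?addr0 // => k kj.
rewrite !mxE; case: eqP => [jk|_]; last by rewrite mulr0.
by rewrite jk ordSK eqxx in kj.
Qed.

Lemma mul_A_mx m (X : 'M[R[i]]_(m, N)) theta i j :
  (X *m A_mx N (pi / 2) theta) i j =
  'i / 2 * (X i (ordS j) + X i (ord_pred j))
  + (cos (2 * pi * j%:R / N%:R + theta))%:C * X i j.
Proof.
have hC : (X *m ('i *: C)) i j = 'i / 2 * (X i (ordS j) + X i (ord_pred j)).
  by rewrite /C scalerA -scalemxAr mulmxDr mxE mxE mul_mx_shift mul_mx_shiftT.
have hD : (X *m D theta) i j = (cos (2 * pi * j%:R / N%:R + theta))%:C * X i j.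
  by rewrite mul_mx_diag mxE mxE mulrC.
by rewrite A_mx_pihalf mulmxDr mxE hC hD addrC.
Qed.

Hypothesis N_even : ~~ odd N.
Hypothesis N_gt0 : (0 < N)%N.

Lemma cos_nodeC theta j :
  (cos (2 * pi * j%:R / N%:R + theta))%:C =
  (w ^+ j * expi theta + (w ^+ j * expi theta)^-1) / 2.
Proof.
by rewrite expiX -expiD (_ : j%:R * _ = 2 * pi * j%:R / N%:R) ?cosC //; ring.
Qed.

(** Up to the sign [(-1) ^+ N], which is 1 here, this is the constant coefficient of [X^N - 1]. *)
Lemma prod_prim_root : \prod_(i < N) w ^+ i = -1.
Proof.
have := congr1 (fun p => p.[0]) (factor_Xn_sub_1 (expi_prim_root R N_gt0)).
rewrite !hornerE expr0n gtn_eqF // add0r horner_prod big_mkord => <-.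
under [RHS]eq_bigr do rewrite !hornerE.
by rewrite prodrN card_ord -signr_odd (negbTE N_even) mul1r.
Qed.

(** Chambers' formula with [a = - 2^-1] and root product -1 leaves only [cos (N theta)]; the unknown
    [p1] cancels against angle 0. *)
Lemma detA_theta theta z : detA theta z =
  detA 0 z + (2 ^ (1 - N%:Z) * (1 - cos (N%:R * theta)))%:C.
Proof.
pose K := z%:M - 'i *: C.
have Kc i j : K (ordS i) (ordS j) = K i j.
  by rewrite !mxE !(inj_eq (@ordS_inj N)).
have [p1 Hp] := det_circulant_diag (- 2^-1) (expi_prim_root R N_gt0) Kc.
have H t : detA t z = p1 - (2 / 2 ^+ N * cos (N%:R * t))%:C.
  rewrite /detA (_ : _ - _ = K + diag_mx (\row_j (- 2^-1 *
      (w ^+ j * expi t + (w ^+ j * expi t)^-1)))).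
    rewrite Hp ?expi_neq0 // prod_prim_root exprNn -signr_odd (negbTE N_even).
    rewrite !rmorphM fmorphV rmorphXn rmorph_nat /= cosC expiX exprVn.
    have := expi_neq0 (N%:R * t); set y := expi _ => y0.
    by field; rewrite y0 expf_neq0.
  rewrite A_mx_pihalf /K opprD addrCA addrC; congr (_ + _); apply/matrixP => i j.
  rewrite !mxE cos_nodeC; case: (i == j); rewrite ?mulr0n ?mulr1n; last by rewrite oppr0.
  by field; rewrite expi_neq0 expf_neq0 ?expi_neq0.
have e : 2 ^ (1 - N%:Z) = 2 / 2 ^+ N :> R by rewrite expfzDr // expr1z exprnN.
rewrite !H mulr0 cos0 mulr1 -addrA; congr (_ + _).
by rewrite e -!rmorphN -rmorphD /=; congr (_ %:C); ring.
Qed.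

(** For even [N] the signs [(-1) ^+ j] alternate consistently around the cycle; conjugating by them
    fixes the diagonal and negates the hopping term. *)
Lemma det_sign a s theta :
  \det (a%:M - D theta - s *: C) = \det (a%:M - D theta + s *: C).
Proof.
pose E : 'M[R[i]]_N := diag_mx (\row_j (-1) ^+ j).
have E0 : \det E != 0.
  by rewrite det_diag; apply/prodf_neq0 => i _; rewrite mxE signr_eq0.
apply: (det_similar E0); apply/matrixP => i j.
have par (k l : 'I_N) : (k == ordS l)%:R * (-1) ^+ k = - ((k == ordS l)%:R * (-1) ^+ l) :> R[i].
  have [->|_] := eqVneq k (ordS l); last by rewrite !mul0r oppr0.
  by rewrite !mul1r /= -[LHS]signr_odd (odd_mod _ (negbTE N_even)) signr_odd exprS mulN1r.
have := par i j; have := par j i; rewrite mul_diag_mx mul_mx_diag !mxE.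
set u := (i == ordS j)%:R; set v := (j == ordS i)%:R.
set e := (-1) ^+ i; set f := (-1) ^+ j => pv pu.
have h : (u + v) * (e + f) = 0 by rewrite mulrDl !mulrDr pu pv; ring.
apply/eqP; rewrite -subr_eq0; apply/eqP.
transitivity (- s / 2 * ((u + v) * (e + f))); last by rewrite h mulr0.
clear h pu pv; rewrite {}/e {}/f; have [ij|_] := eqVneq i j; last by rewrite !mulr0n; ring.
by move: u v; rewrite ij => u v; ring.
Qed.

Lemma det_fourier_mx : \det (Vandermonde N (\row_(j < N) w ^+ j)) != 0.
Proof.
rewrite det_Vandermonde; apply/prodf_neq0 => i _; apply/prodf_neq0 => j ij.
rewrite !mxE subr_eq0 (eq_prim_root_expr (expi_prim_root R N_gt0)) !modn_small //.
by rewrite gtn_eqF.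
Qed.

(** The Fourier matrix diagonalises the shift: [F *m C = D 0 *m F]. Since [F] and [C] are symmetric,
    transposing gives the reverse exchange. *)
Lemma det_fourier a b s :
  \det (a%:M - b *: D 0 - s *: C) = \det (a%:M - b *: C - s *: D 0).
Proof.
pose F := Vandermonde N (\row_(j < N) w ^+ j).
have wN := expi_prim_root R N_gt0.
have F0 : \det F != 0 := det_fourier_mx.
have FT : F^T = F by apply/matrixP => i j; rewrite !mxE -!exprM mulnC.
have FC : F *m C = D 0 *m F.
  have FS i j : F i (ordS j) = w ^+ i * F i j.
    by rewrite !mxE /= (expr_mod _ (prim_expr_order wN)) exprS exprMn.
  rewrite /C -scalemxAr mulmxDr; apply/matrixP => i j.
  rewrite mxE [X in _ * X]mxE mul_mx_shift mul_mx_shiftT mul_diag_mx [RHS]mxE.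
  rewrite [X in _ = X * _]mxE cos_nodeC expi0 mulr1.
  have e := FS i (ord_pred j); rewrite ord_predK in e; rewrite FS e.
  by field; rewrite expf_neq0 ?expi_neq0.
have FD : F *m D 0 = C *m F.
  have CT : C^T = C by apply/matrixP => i j; rewrite mxE !mxCE addrC.
  by apply: trmx_inj; rewrite [LHS]trmx_mul [RHS]trmx_mul FT tr_diag_mx CT FC.
apply: (det_similar F0).
rewrite !mulmxBr !mulmxBl -(scalemxAr s F C) -(scalemxAr b F (D 0)).
rewrite -(scalemxAl b C F) -(scalemxAl s (D 0) F) FC FD.
by rewrite mul_mx_scalar mul_scalar_mx.
Qed.

(** [C] and [D 0] are real, so conjugation acts on [z] and flips the sign of ['i *: C]; [det_sign]
    absorbs that sign. *)
Lemma conj_detA0 z : (detA 0 z)^* = detA 0 z^*.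
Proof.
rewrite /detA A_mx_pihalf !opprD !addrA [RHS]det_sign -det_map_mx.
congr (\det _); apply/matrixP => i j; rewrite mxE -[LHS]/(conjc _).
have [c cE] : exists c : R, C i j = c%:C.
  exists (((i == ordS j)%:R + (j == ordS i)%:R) / 2).
  by rewrite mxCE rmorphM fmorphV rmorphD !rmorph_nat.
pose t : R := cos (2 * pi * i%:R / N%:R + 0).
have -> : (z%:M - D 0 - 'i *: C) i j = z *+ (i == j) - t%:C *+ (i == j) - 'i * c%:C.
  by rewrite -cE !mxE.
have -> : (z^*%:M - D 0 + 'i *: C) i j =
    z^* *+ (i == j) - t%:C *+ (i == j) + 'i * c%:C.
  by rewrite -cE !mxE.
by case: (i == j); case: z => x y; apply/eqP; rewrite eq_complex /=;
  apply/andP; split; apply/eqP; ring.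
Qed.

(** Fourier exchange, then extraction of the scalar ['i], which contributes ['i ^+ N = -1] as [N] is
    2 modulo 4. *)
Lemma detA0_rot m z : N = (4 * m + 2)%N -> detA 0 z = - detA 0 (- 'i * z).
Proof.
move=> hN; rewrite /detA A_mx_pihalf !opprD !addrA.
rewrite -[X in z%:M - X - _]scale1r det_fourier scale1r.
rewrite mx_quarter_turn.
have iN : 'i ^+ N = -1 :> R[i].
  rewrite hN exprD exprM (_ : 'i ^+ 4 = 1) ?expr1n ?sqr_i ?mul1r //.
  by rewrite (exprM _ 2 2) sqr_i -signr_odd.
by rewrite detZ det_sign iN mulN1r.
Qed.

(** On one arm [z^* = - 'i * z], on the other [- 'i * z^* = z]: conjugation acts as a quarter
    turn. *)
Lemma detA0_cross m z : N = (4 * m + 2)%N -> cross_pi4 R z ->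
  (detA 0 z)^* = - detA 0 z.
Proof.
move=> hN zX; rewrite conj_detA0.
have conjE (x t : R) : (expi x * t%:C)^* = expi (- x) * t%:C.
  by rewrite rmorphM /= oppr0 -[_ -i* _]/(conjc (expi x)) conjc_expi expiN.
have ei : expi (- (pi / 2)) = - 'i :> R[i].
  by rewrite /expi cosN sinN cos_pihalf sin_pihalf; apply/eqP; rewrite eq_complex /= oppr0 !eqxx.
have [e|e] : conjc z = - 'i * z \/ - 'i * conjc z = z.
  case: zX => -[t _ <-]; [left|right]; rewrite conjE -ei mulrA -expiD.
    by congr (expi _ * _); field.
  by congr (_ * _); rewrite -[LHS]expiD_2pi; congr expi; field.
  by rewrite e [in RHS](detA0_rot z hN) opprK.
by rewrite (detA0_rot _ hN) e.
Qed.

(* On the cross the determinant at [theta = 0] is purely imaginary, whereas the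
   [theta]-dependent correction is real. *)
Lemma detA_cross m theta z : N = (4 * m + 2)%N -> cross_pi4 R z ->
  detA theta z = 0 -> cos (N%:R * theta) = 1.
Proof.
move=> hN zX; rewrite detA_theta => /eqP; rewrite addr_eq0 => /eqP e.
have := detA0_cross hN zX; rewrite e.
set c := _ * _ => /(congr1 (@complex.Re R)) /= c0.
have {}c0 : c == 0 by apply/eqP; lra.
move: c0; rewrite mulf_eq0 subr_eq0 => /orP[|/eqP <- //].
by rewrite expfz_eq0 pnatr_eq0 andbF.
Qed.

End Matrices.

(** * Weighted periodic Jacobi operators *)

Section ComplexModulus.
Variable R : realType.
Implicit Types z : R[i].

Lemma cabsE z : cabs z = Num.sqrt (complex.Re z ^+ 2 + complex.Im z ^+ 2).
Proof. by case: z. Qed.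

Lemma cabs_ge0 z : 0 <= cabs z.
Proof. by rewrite cabsE sqrtr_ge0. Qed.

Lemma sqr_cabs z : cabs z ^+ 2 = complex.Re z ^+ 2 + complex.Im z ^+ 2.
Proof. by rewrite cabsE sqr_sqrtr // addr_ge0 ?sqr_ge0. Qed.

Lemma cabsM z z' : cabs (z * z') = cabs z * cabs z'.
Proof. exact: (@Normc.normcM R). Qed.

Lemma cabs_eq0 z : (cabs z == 0) = (z == 0).
Proof. exact: (@normr_eq0 R (Rcomplex R)). Qed.

Lemma cabs_conj z : cabs (z^*) = cabs z.
Proof. by rewrite !cabsE; case: z => x y /=; rewrite sqrrN. Qed.

Lemma cabs_real (x : R) : cabs x%:C = `|x|.
Proof. by rewrite cabsE /= expr0n addr0 sqrtr_sqr. Qed.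

Lemma mulc_conj z : z * z^* = (cabs z ^+ 2)%:C.
Proof.
rewrite sqr_cabs; case: z => x y; apply/eqP; rewrite eq_complex /=.
by apply/andP; split; apply/eqP; ring.
Qed.

Lemma normRe_le_cabs z : `|complex.Re z| <= cabs z.
Proof.
by rewrite cabsE -sqrtr_sqr ler_wsqrtr // lerDl sqr_ge0.
Qed.

End ComplexModulus.

Lemma sum_shift_periodic (V : nmodType) (N : nat) (f : nat -> V) :
  f N = f 0%N -> \sum_(k < N) f k.+1 = \sum_(k < N) f k.
Proof.
case: N => [|N] fN; first by rewrite !big_ord0.
by rewrite big_ord_recr big_ord_recl /= fN addrC.
Qed.

(* In the inner product with weights [rho] the operator
   [u |-> c k * u (k+1) + b (k-1) * u (k-1)] is a sum of a Hermitian and an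
   anti-Hermitian part up to a common phase, the sign [s k] telling to which of
   them the link between [k] and [k+1] belongs. Only the two-step hops across a
   sign change contribute to [Re z^2]. *)
Lemma weighted_re_sum (R : realType) (N : nat) (u c b : nat -> R[i])
    (rho s : nat -> R) (z : R[i]) :
  (forall k, u (k + N)%N = u k) -> (forall k, c (k + N)%N = c k) ->
  (forall k, rho (k + N)%N = rho k) ->
  (forall k, z * u k.+1 = c k.+1 * u k.+2 + b k * u k) ->
  (forall k, (k <= N)%N -> (rho k.+1)%:C * b k = 'i * (s k * rho k)%:C * (c k)^*) ->
  (forall k, complex.Re (c k * b k) = 0) ->
  complex.Re (z ^+ 2) * \sum_(k < N) rho k * cabs (u k) ^+ 2 =
  \sum_(k < N) (1 - s k * s k.+1) *
               (rho k * complex.Re (c k * c k.+1 * (u k)^* * u k.+2)).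
Proof.
move=> uN cN rN rec rel cb.
pose Y k := rho k * complex.Re (c k * c k.+1 * (u k)^* * u k.+2).
have key k : (k < N)%N -> complex.Re (z ^+ 2) * (rho k.+2 * cabs (u k.+2) ^+ 2) =
    Y k.+2 - s k * s k.+1 * Y k.
  (* The relation is used at [k] and at [k.+1], hence its range up to [k = N]. *)
  move=> kN; have relk := rel k (ltnW kN); have relk1 := rel k.+1 kN.
  have e1 : z ^+ 2 * u k.+2 = c k.+2 * c k.+3 * u k.+4
      + (c k.+2 * b k.+2 + c k.+1 * b k.+1) * u k.+2 + b k.+1 * b k * u k.
    rewrite expr2 -mulrA rec mulrDr mulrCA rec mulrCA rec.
    by ring.
  (* The double hop downwards is the adjoint of the one upwards up to [- s k * s k.+1], the minus
     sign being ['i ^+ 2]. *)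
  have e2 : (rho k.+2)%:C * (b k.+1 * b k) =
      - (s k * s k.+1 * rho k)%:C * ((c k.+1)^* * (c k)^*).
    rewrite mulrA relk1.
    transitivity ('i * (s k.+1)%:C * (c k.+1)^* * ((rho k.+1)%:C * b k)).
      by rewrite rmorphM; ring.
    rewrite relk; transitivity ('i ^+ 2 * ((s k * s k.+1 * rho k)%:C * ((c k.+1)^* * (c k)^*))).
      by rewrite !rmorphM; ring.
    by rewrite sqr_i mulN1r mulNr.
  have e3 : z ^+ 2 * (rho k.+2 * cabs (u k.+2) ^+ 2)%:C =
      (rho k.+2)%:C * (c k.+2 * c k.+3 * (u k.+2)^* * u k.+4)
      + (c k.+2 * b k.+2 + c k.+1 * b k.+1) * (rho k.+2 * cabs (u k.+2) ^+ 2)%:C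
      - (s k * s k.+1 * rho k)%:C * ((c k)^* * (c k.+1)^* * u k * (u k.+2)^*).
    rewrite rmorphM /= -mulc_conj.
    transitivity ((rho k.+2)%:C * (u k.+2)^* * (z ^+ 2 * u k.+2)); first by ring.
    rewrite e1 !mulrDr.
    transitivity ((rho k.+2)%:C * (c k.+2 * c k.+3 * (u k.+2)^* * u k.+4)
      + (c k.+2 * b k.+2 + c k.+1 * b k.+1) * ((rho k.+2)%:C * (u k.+2 * (u k.+2)^*))
      + ((rho k.+2)%:C * (b k.+1 * b k)) * (u k * (u k.+2)^*)); first by ring.
    by rewrite e2; ring.
  have ReM (x : R) (y : R[i]) : complex.Re (x%:C * y) = x * complex.Re y.
    by case: y => y1 y2 /=; rewrite mul0r subr0.
  have ReMr (x : R) (y : R[i]) : complex.Re (y * x%:C) = complex.Re y * x.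
    by case: y => y1 y2 /=; rewrite mulr0 subr0.
  have ReD (x y : R[i]) : complex.Re (x + y) = complex.Re x + complex.Re y.
    by case: x; case: y.
  have ReB (x y : R[i]) : complex.Re (x - y) = complex.Re x - complex.Re y.
    by case: x; case: y.
  rewrite -ReMr e3 ReB ReD !ReM ReMr ReD !cb addr0 mul0r addr0 /Y -[in RHS]mulrA.
  congr (_ - _); rewrite mulrA; congr (_ * _).
  by case: (c k) (c k.+1) (u k) (u k.+2) => [? ?] [? ?] [? ?] [? ?] /=; ring.
have per f : (forall k, f (k + N)%N = f k :> R) -> \sum_(k < N) f k.+2 = \sum_(k < N) f k.
  move=> fN; rewrite -(sum_shift_periodic (fN 0%N)).
  exact: (sum_shift_periodic (f := fun k => f k.+1) (fN 1%N)).
rewrite -(per (fun k => rho k * cabs (u k) ^+ 2)) => [|k]; last by rewrite uN rN.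
rewrite mulr_sumr; under eq_bigr => k _ do rewrite key //.
rewrite sumrB per => [|k]; last by rewrite /Y -!addSn !uN !cN rN.
by rewrite -sumrB; apply: eq_bigr => k _; rewrite mulrBl mul1r.
Qed.

(** * Distances to the cross and to the lattice *)

Section Distances.
Variable R : realType.

Lemma dist_ge0 (V : normedZmodType R) (x : V) (A : set V) : 0 <= dist x A.
Proof.
(* The infimum of the empty set is 0 by convention. *)
rewrite /dist; have [->|/set0P A0] := eqVneq A set0.
  by rewrite image_set0 inf0.
by apply: lb_le_inf; [exact: image_nonempty|move=> _ [y _ <-]; exact: normr_ge0].
Qed.

Lemma dist_le (V : normedZmodType R) (x y : V) (A : set V) :
  A y -> dist x A <= `|x - y|.
Proof.
move=> Ay; apply: ge_inf; last by exists y.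
by exists 0 => _ [t _ <-]; exact: normr_ge0.
Qed.

Lemma dist_eq (V : normedZmodType R) (x y : V) (A : set V) :
  A y -> (forall t, A t -> `|x - y| <= `|x - t|) -> dist x A = `|x - y|.
Proof.
move=> Ay miny; apply/eqP; rewrite eq_le dist_le //=.
by apply: lb_le_inf; [exists `|x - y|, y|move=> _ [t At <-]; exact: miny].
Qed.

Lemma cdist_le (z y : R[i]) (A : set R[i]) : A y -> cdist z A <= cabs (z - y).
Proof. by move=> Ay; exact: (@dist_le (Rcomplex R) z y A Ay). Qed.

Lemma cos_piquarter : cos (pi / 4) = (Num.sqrt 2)^-1 :> R.
Proof.
have p0 := pi_gt0 R.
have c0 : 0 < cos (pi / 4 : R) by apply: cos_gt0_pihalf; apply/andP; split; lra.
have := cos_mulr2n (pi / 4 : R); rewrite (_ : (pi / 4) *+ 2 = pi / 2 :> R); last by field.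
rewrite cos_pihalf => e; have {}e : cos (pi / 4 : R) ^+ 2 = 2^-1 by lra.
by rewrite -[LHS]ger0_norm ?ltW // -sqrtr_sqr e sqrtrV.
Qed.

Lemma sin_piquarter : sin (pi / 4) = (Num.sqrt 2)^-1 :> R.
Proof. by rewrite -cos_piquarter -cosBpihalf -cosN; congr cos; field. Qed.

Lemma cross_diag (t : R) : cross_pi4 R (t +i* t) /\ cross_pi4 R (t -i* t).
Proof.
have s0 : Num.sqrt 2 != 0 :> R by rewrite sqrtr_eq0 -ltNge ltr0n.
split; [left; exists (t * Num.sqrt 2)|right; exists (- t * Num.sqrt 2)] => //.
  rewrite /expi cos_piquarter sin_piquarter; apply/eqP; rewrite eq_complex /=.
  by apply/andP; split; apply/eqP; field.
have -> : 3 * pi / 4 = pi / 4 + pi / 2 :> R by field.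
rewrite /expi cosDpihalf sinDpihalf cos_piquarter sin_piquarter.
apply/eqP; rewrite eq_complex /=.
by apply/andP; split; apply/eqP; field.
Qed.

(** For [z = x + i y] the condition is [x ^ 2 = y ^ 2], and the cross is the union of the two
    diagonals. *)
Lemma crossP (z : R[i]) : cross_pi4 R z <-> complex.Re (z ^+ 2) = 0.
Proof.
case: z => x y; split.
  have h (t a : R) : complex.Re ((expi a * t%:C) ^+ 2) = t ^+ 2 * cos (a *+ 2).
    by rewrite cos_mulr2n -(cos2Dsin2 a) expr2 /=; ring.
  case=> -[t _ <-]; rewrite h.
    by rewrite (_ : (pi / 4) *+ 2 = pi / 2 :> R) ?cos_pihalf ?mulr0 //; field.
  rewrite (_ : (3 * pi / 4) *+ 2 = pi / 2 + pi :> R) ?cosDpi ?cos_pihalf ?oppr0 ?mulr0 //.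
  by field.
rewrite expr2 /= -!expr2 => /eqP; rewrite subr_eq0 eqf_sqr => /orP[] /eqP ->.
  exact: (cross_diag y).1.
by have := (cross_diag (- y)).2; rewrite opprK.
Qed.

(** [Re (z ^ 2) = p * q], where [|p|] and [|q|] are [sqrt 2] times the distances to the two
    diagonals. The smaller one squared is at most [|p q|], and [cabs z] is at most the larger one.
    The second bound is multiplied out so as to include [z = 0]. *)
Lemma cdist_cross (z : R[i]) (g : R) : `|complex.Re (z ^+ 2)| <= g ->
  cdist z (cross_pi4 R) <= Num.sqrt (g / 2) /\
  cdist z (cross_pi4 R) * (Num.sqrt 2 * cabs z) <= g.
Proof.
case: z => x y; rewrite expr2 /= -!expr2 => hg.
pose p := x - y; pose q := x + y.
have hpq : `|p| * `|q| <= g by rewrite -normrM /p /q -subr_sqr.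
(* The witness is the orthogonal projection of [z] to the diagonal. *)
have dp : cdist (x +i* y) (cross_pi4 R) <= `|p| / Num.sqrt 2.
  apply: le_trans (cdist_le _ (cross_diag ((x + y) / 2)).1) _.
  rewrite cabsE /= (_ : _ + _ = p ^+ 2 / 2); last by rewrite /p; field.
  by rewrite sqrtrM ?sqr_ge0 // sqrtr_sqr sqrtrV.
have dq : cdist (x +i* y) (cross_pi4 R) <= `|q| / Num.sqrt 2.
  apply: le_trans (cdist_le _ (cross_diag ((x - y) / 2)).2) _.
  rewrite cabsE /= (_ : _ + _ = q ^+ 2 / 2); last by rewrite /q; field.
  by rewrite sqrtrM ?sqr_ge0 // sqrtr_sqr sqrtrV.
set D := cdist _ _ in dp dq *.
have D0 : 0 <= D by exact: dist_ge0.
have s0 : 0 < Num.sqrt 2 :> R by rewrite sqrtr_gt0.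
have ss : Num.sqrt 2 ^+ 2 = 2 :> R by rewrite sqr_sqrtr.
have p0 := normr_ge0 p; have q0 := normr_ge0 q.
rewrite !ler_pdivlMr // in dp dq.
split.
  rewrite -[D]ger0_norm // -sqrtr_sqr ler_wsqrtr //.
  have : (D * Num.sqrt 2) * (D * Num.sqrt 2) <= `|p| * `|q|.
    by apply: ler_pM => //; rewrite mulr_ge0 // ltW.
  rewrite mulrACA -!expr2 ss => h; have : D ^+ 2 * 2 <= g by apply: le_trans hpq.
  by lra.
rewrite mulrA.
have hz : cabs (x +i* y) <= Num.max `|p| `|q|.
  have m0 : 0 <= Num.max `|p| `|q| by rewrite le_max p0.
  rewrite -[leRHS]ger0_norm // -sqrtr_sqr cabsE ler_wsqrtr //=.
  have p2 : `|p| ^+ 2 <= Num.max `|p| `|q| ^+ 2 by rewrite lerXn2r ?nnegrE // le_max lexx.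
  have q2 : `|q| ^+ 2 <= Num.max `|p| `|q| ^+ 2 by rewrite lerXn2r ?nnegrE // le_max lexx orbT.
  have : `|p| ^+ 2 + `|q| ^+ 2 = 2 * (x ^+ 2 + y ^+ 2).
    by rewrite !real_normK ?num_real // /p /q; ring.
  by lra.
apply: le_trans hpq.
case: (leP `|p| `|q|) hz => _ hz.
  by apply: ler_pM; rewrite ?mulr_ge0 ?cabs_ge0 ?(ltW s0).
by rewrite [leRHS]mulrC; apply: ler_pM; rewrite ?mulr_ge0 ?cabs_ge0 ?(ltW s0).
Qed.

End Distances.

Section DistanceToLattice.
Variables (R : realType) (N : nat).
Hypothesis N_gt0 : (0 < N)%N.

Let Nr_gt0 : 0 < N%:R :> R. Proof. by rewrite ltr0n. Qed.

Lemma cosD_2pi_int (x : R) (k : int) : cos (x + 2 * pi * k%:~R) = cos x.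
Proof.
have h (y : R) (n : nat) : cos (y + 2 * pi * n%:R) = cos y.
  have -> : 2 * pi * n%:R = (pi *+ 2) *+ n :> R by rewrite mulr_natr mulr_natl.
  exact: (periodicn (@cosD2pi R)).
case: k => n; first exact: h.
by rewrite -[LHS](h _ n.+1) NegzE mulrNz; congr cos; ring.
Qed.

Lemma dN_attained (theta : R) : exists k : int,
  dN N theta = `|theta - 2 * pi / N%:R * k%:~R| /\ dN N theta <= pi / N%:R.
Proof.
have p0 := pi_gt0 R; pose L : R := 2 * pi / N%:R.
have L0 : 0 < L by rewrite divr_gt0 ?mulr_gt0.
(* Rounds [theta / L] to a nearest integer; all other lattice points are at least [L] away from the
   chosen one. *)
pose k := Num.floor (theta / L + 2^-1).
have hk : `|theta - L * k%:~R| <= L / 2.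
  have /andP[] := floor_itv (theta / L + 2^-1); rewrite -/k intrD mulr1z => h1 h2.
  have -> : theta - L * k%:~R = L * (theta / L - k%:~R).
    by rewrite mulrBr mulrCA divff ?mulr1 ?gt_eqF.
  rewrite normrM gtr0_norm // ler_pM2l // ler_norml; apply/andP; split; lra.
have dE : dN N theta = `|theta - L * k%:~R|.
  apply: dist_eq; first by exists k.
  move=> _ [j _ <-]; rewrite -/L.
  have [<- //|kj] := eqVneq k j.
  have : L <= `|L * k%:~R - L * j%:~R|.
    rewrite -mulrBr normrM gtr0_norm // -{1}[L]mulr1 ler_pM2l // -intrB -intr_norm.
    by rewrite ler1z -gtz0_ge1 normr_gt0 subr_eq0.
  have := ler_normD (theta - L * j%:~R) (L * k%:~R - theta).
  rewrite [`|_ - theta|]distrC addrC addrA subrK.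
  by lra.
have hL : L / 2 = pi / N%:R by rewrite /L; field; rewrite gt_eqF.
by exists k; split=> //; rewrite dE -hL.
Qed.

Lemma dN_itv (theta : R) : 0 <= dN N theta <= pi / N%:R.
Proof. by have [k [_ ->]] := dN_attained theta; rewrite dist_ge0. Qed.

(** As [detA] depends on the angle only through [cos (N theta)], this lets [dN N theta] replace
    [theta]. *)
Lemma cos_dN (theta : R) : cos (N%:R * dN N theta) = cos (N%:R * theta).
Proof.
have [k [-> _]] := dN_attained theta.
rewrite -[X in cos (X * _)]ger0_norm ?ler0n // -normrM cos_norm.
rewrite -[RHS](cosD_2pi_int _ (- k)); congr cos; rewrite mulrNz.
by field; rewrite gt_eqF.
Qed.

Lemma dN_eq0 (theta : R) : dN N theta = 0 <-> lattice R N theta.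
Proof.
split=> [|thL]; last first.
  by apply/eqP; rewrite eq_le dist_ge0 andbT -(normr0 R) -(subrr theta) dist_le.
have [k [-> _]] := dN_attained theta => /eqP.
by rewrite normr_eq0 subr_eq0 => /eqP ->; exists k.
Qed.

Lemma cos_eq1_lattice (theta : R) : cos (N%:R * theta) = 1 -> lattice R N theta.
Proof.
rewrite -cos_dN => /cos_eq1 c; apply/dN_eq0; apply/eqP.
have /andP[d0 d1] := dN_itv theta; have p0 := pi_gt0 R.
have /eqP : N%:R * dN N theta = 0.
  apply: c; rewrite mulr_ge0 ?ler0n //=; rewrite ler_pdivlMr // in d1.
  by apply: le_lt_trans (_ : _ <= pi) _; [rewrite mulrC | lra].
by rewrite mulf_eq0 (gt_eqF Nr_gt0).
Qed.

Definition gamma_at (d : R) : R :=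
  2^-1 * Num.sqrt (sin d * sin (2 * pi / N%:R - d)).

(** With [x = pi / N - d] the product of sines equals [sin (pi / N) ^ 2 - sin x ^ 2]. *)
Lemma gamma_at_le (d : R) : (1 < N)%N -> gamma_at d <= 2^-1 * sin (pi / N%:R).
Proof.
move=> N1; have p0 := pi_gt0 R.
have s0 : 0 <= sin (pi / N%:R : R).
  apply: sin_ge0_pi; rewrite divr_ge0 ?(ltW p0) ?ler0n //= ler_pdivrMr // ler_peMr ?(ltW p0) //.
  by rewrite ler1n.
rewrite ler_pM2l ?invr_gt0 // -[leRHS]ger0_norm // -sqrtr_sqr ler_wsqrtr //.
have e1 : 2 * pi / N%:R - d = pi / N%:R + (pi / N%:R - d) :> R by ring.
have e2 : d = pi / N%:R - (pi / N%:R - d) :> R by ring.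
rewrite e1 {1}e2; move: (_ - d) => x; rewrite sinB sinD.
set S := sin (pi / _); set C := cos (pi / _).
have h1 : C ^+ 2 = 1 - S ^+ 2 by exact: cos2sin2.
have h2 : cos x ^+ 2 = 1 - sin x ^+ 2 by exact: cos2sin2.
rewrite (_ : _ * _ = S ^+ 2 * cos x ^+ 2 - C ^+ 2 * sin x ^+ 2); last by ring.
by rewrite h1 h2; have := sqr_ge0 (sin x); lra.
Qed.

End DistanceToLattice.

(** * The chirped Fourier transform *)

(* The vector [u k] below is the Fourier transform of [v] multiplied by a chirp;
   it turns the operator into a periodic Jacobi operator with zero diagonal
   whose links satisfy [c k * b k = 'i / 2 * cos (pi (2 k + 1) / N - d)]. *)
Section Chirp.
Variables (R : realType) (m N : nat).
Hypothesis hN : N = (4 * m + 2)%N.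
Variable d : R.

Let N_gt0 : (0 < N)%N. Proof. by rewrite hN addn2. Qed.
Let N_even : ~~ odd N. Proof. by rewrite hN oddD oddM. Qed.
Let Nr_neq0 : N%:R != 0 :> R. Proof. by rewrite pnatr_eq0 -lt0n. Qed.

Local Notation eta := (expi (pi / N%:R : R)).
Local Notation zeta := (expi d).

(** In both links the [eta] term stems from the shifts and the [zeta] term from the cosine
    diagonal. *)
Definition link_up k : R[i] := ('i * eta ^+ (2 * k + 1) + zeta) / 2.
Definition link_down k : R[i] := ('i * eta ^- (2 * k + 1) + zeta^-1) / 2.
Definition link_cos k : R := cos (pi / N%:R * (2 * k + 1)%:R - d).

Lemma eta_N : eta ^+ N = -1.
Proof. by rewrite expiX mulrC divfK // expi_pi. Qed.

Lemma eta_periodic k q : eta ^+ (k + 2 * N * q) = eta ^+ k.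
Proof. by rewrite exprD exprM mulnC exprM eta_N sqrrN expr1n expr1n mulr1. Qed.

Lemma link_up_periodic k : link_up (k + N) = link_up k.
Proof.
rewrite /link_up (_ : 2 * (k + N) + 1 = 2 * k + 1 + 2 * N * 1)%N ?eta_periodic //.
by lia.
Qed.

Lemma link_down_periodic k : link_down (k + N) = link_down k.
Proof.
rewrite /link_down (_ : 2 * (k + N) + 1 = 2 * k + 1 + 2 * N * 1)%N ?eta_periodic //.
by lia.
Qed.

(** Half a period is [2 * m + 1] steps and multiplies [eta ^+ (2 * k + 1)] by [eta ^+ N = -1], the
    sign that conjugation gives to ['i]. *)
Lemma link_down_half k : link_down (k + 2 * m + 1) = (link_up k)^*.
Proof.
rewrite /link_down /link_up.
have -> : (2 * (k + 2 * m + 1) + 1 = 2 * k + 1 + N)%N by rewrite hN; lia.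
rewrite exprD eta_N mulrN1 invrN mulrN.
have conj_half (x : R[i]) : (x / 2)^* = x^* / 2.
  have -> : 2^-1 = (2^-1)%:C :> R[i] by rewrite fmorphV rmorph_nat.
  by case: x => x y; apply/eqP; rewrite eq_complex /=; apply/andP; split; apply/eqP; ring.
rewrite conj_half; congr (_ / _); rewrite expiX -!conjc_expi.
by apply/eqP; rewrite eq_complex /=; apply/andP; split; apply/eqP; ring.
Qed.

Lemma link_mul k : link_up k * link_down k = 'i / 2 * (link_cos k)%:C.
Proof.
rewrite /link_up /link_down /link_cos cosC.
have -> : expi (pi / N%:R * (2 * k + 1)%:R - d) = eta ^+ (2 * k + 1) / zeta.
  by rewrite expiX -expiN -expiD mulrC.
have := expf_neq0 (2 * k + 1) (expi_neq0 (pi / N%:R : R)); set x := _ ^+ _ => x0.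
have z0 := expi_neq0 d.
transitivity (('i ^+ 2 + 1 + 'i * (x / zeta + zeta / x)) / 4).
  by field; rewrite x0 z0.
by rewrite sqr_i; field; rewrite x0 z0.
Qed.

(** Completing the square, this is [eta ^+ ((j + k) ^ 2)] over [eta ^+ (k ^ 2)], so a step in [j] is
    a step in [k] up to a phase. *)
Definition chirp k j : R[i] := eta ^+ (j ^ 2 + 2 * j * k).

Lemma chirpN k : chirp k N = 1.
Proof.
rewrite /chirp (_ : N ^ 2 + 2 * N * k = N * N + 2 * N * k)%N ?eta_periodic //.
by rewrite exprM eta_N -signr_odd (negbTE N_even).
Qed.

Lemma chirp_ordS k (j : 'I_N) :
  chirp k (ordS j) = eta ^+ (2 * k + 1) * chirp k.+1 j.
Proof.
have -> : chirp k (ordS j) = chirp k j.+1.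
  rewrite /=; have [lt|ge] := ltnP j.+1 N; first by rewrite modn_small.
  have -> : j.+1 = N by apply/eqP; rewrite eqn_leq ltn_ord.
  by rewrite modnn chirpN /chirp exp0n // muln0 mul0n expr0.
by rewrite /chirp -exprD; congr (_ ^+ _); rewrite -!mulnn; lia.
Qed.

Variables (z : R[i]) (v : 'rV[R[i]]_N).
Hypothesis v_eigen : v *m A_mx N (pi / 2) d = z *: v.

Definition chirp_transform k : R[i] := \sum_(j < N) chirp k j * v 0 j.
Local Notation u := chirp_transform.

Lemma chirp_transform_periodic k : u (k + N) = u k.
Proof.
apply: eq_bigr => j _; rewrite /chirp.
have -> : (j ^ 2 + 2 * j * (k + N) = j ^ 2 + 2 * j * k + 2 * N * j)%N.
  by rewrite mulnDr addnA (mulnAC 2 j N).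
by rewrite eta_periodic.
Qed.

Lemma chirp_transform_rec k :
  z * u k.+1 = link_up k.+1 * u k.+2 + link_down k * u k.
Proof.
have eta0 n : eta ^+ n != 0 by rewrite expf_neq0 ?expi_neq0.
have S1 : \sum_(j < N) chirp k.+1 j * v 0 (ordS j) = eta ^- (2 * k + 1) * u k.
  rewrite /u [in RHS](reindex_inj (@ordS_inj N)) /= mulr_sumr; apply: eq_bigr => j _.
  by rewrite chirp_ordS !mulrA mulVf ?mul1r.
have S2 : \sum_(j < N) chirp k.+1 j * v 0 (ord_pred j) = eta ^+ (2 * k.+1 + 1) * u k.+2.
  rewrite /u (reindex_inj (@ordS_inj N)) /= mulr_sumr; apply: eq_bigr => j _.
  by rewrite chirp_ordS ordSK mulrA.
have S3 : \sum_(j < N) chirp k.+1 j * ((cos (2 * pi * j%:R / N%:R + d))%:C * v 0 j)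
    = (zeta * u k.+2 + zeta^-1 * u k) / 2.
  rewrite /u [RHS]mulrC [in RHS]mulrDr !mulr_sumr -big_split /=; apply: eq_bigr => j _.
  rewrite cos_nodeC.
  have -> : expi (2 * pi / N%:R) = eta ^+ 2 :> R[i] by rewrite expiX; congr expi; ring.
  have c2 : chirp k.+2 j = chirp k.+1 j * eta ^+ (2 * j).
    by rewrite /chirp -exprD; congr (_ ^+ _); lia.
  have c1 : chirp k.+1 j = chirp k j * eta ^+ (2 * j).
    by rewrite /chirp -exprD; congr (_ ^+ _); lia.
  rewrite c2 c1 -exprM.
  by field; rewrite (eta0 (2 * j)%N) expi_neq0.
have E j : z * v 0 j = 'i / 2 * (v 0 (ordS j) + v 0 (ord_pred j))
    + (cos (2 * pi * j%:R / N%:R + d))%:C * v 0 j.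
  by rewrite -mul_A_mx v_eigen mxE.
transitivity ('i / 2 * (eta ^- (2 * k + 1) * u k + eta ^+ (2 * k.+1 + 1) * u k.+2)
              + (zeta * u k.+2 + zeta^-1 * u k) / 2); last first.
  by rewrite /link_up /link_down; field; rewrite ?expi_neq0 ?eta0.
rewrite -S1 -S2 -S3 /u mulr_sumr.
under eq_bigr => j _ do rewrite mulrCA E mulrDr mulrCA mulrDr.
by rewrite big_split /= -mulr_sumr big_split.
Qed.

(** [u] is an invertible Fourier matrix applied to [v] with its entries multiplied by nonzero
    phases. *)
Lemma chirp_transform_neq0 : v != 0 -> exists k : 'I_N, u k != 0.
Proof.
move=> v0; apply/existsP; apply: contraNT v0; rewrite negb_exists => /forallP u0.
pose F := Vandermonde N (\row_(j < N) expi (2 * pi / N%:R : R) ^+ j).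
pose y : 'rV[R[i]]_N := \row_j (eta ^+ (j ^ 2) * v 0 j).
have uF : F^T \in unitmx.
  by rewrite unitmx_tr unitmxE unitfE det_fourier_mx.
have yF : y *m F^T = 0.
  apply/rowP => k; rewrite !mxE; have := u0 k; rewrite negbK => /eqP uk; rewrite -[RHS]uk /u.
  apply: eq_bigr => j _; rewrite !mxE /chirp exprD mulrAC.
  by congr (_ * _ * _); rewrite -exprM !expiX; congr expi; rewrite !natrM; ring.
have y0 : y = 0 by rewrite -[y](mulmxK uF) yF mul0mx.
apply/eqP/rowP => j; have /rowP/(_ j) := y0; rewrite !mxE => /eqP.
by rewrite mulf_eq0 expf_eq0 (negbTE (expi_neq0 _)) andbF => /eqP.
Qed.

End Chirp.

(** * The bound on [Re z^2] *)

(** The weight relations make the squared amplitude [g ^ 2] times the product of the two masses [P]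
    and [Q]; then arithmetic and geometric means are compared. *)
Lemma hop_le (R : realType) (r0 r1 r2 g : R) (c0 c1 b0 b1 u0 u2 : R[i]) :
  0 <= r0 -> 0 <= r2 -> 0 <= g ->
  r1 * cabs b0 = r0 * cabs c0 -> r2 * cabs b1 = r1 * cabs c1 ->
  cabs (c0 * b0) * cabs (c1 * b1) = g ^+ 2 ->
  2 * `|r0 * complex.Re (c0 * c1 * u0^* * u2)| <=
  g * (r0 * cabs u0 ^+ 2 + r2 * cabs u2 ^+ 2).
Proof.
move=> r00 r20 g0 e0 e1 eg.
pose T := r0 * cabs (c0 * c1 * u0^* * u2).
have T0 : 0 <= T by apply: mulr_ge0 => //; exact: cabs_ge0.
have le_T : `|r0 * complex.Re (c0 * c1 * u0^* * u2)| <= T.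
  by rewrite normrM ger0_norm // ler_wpM2l // normRe_le_cabs.
apply: le_trans (_ : 2 * T <= _); first by rewrite ler_pM2l.
set P := r0 * _; set Q := r2 * _.
have P0 : 0 <= P by rewrite mulr_ge0 ?sqr_ge0.
have Q0 : 0 <= Q by rewrite mulr_ge0 ?sqr_ge0.
have TT : T ^+ 2 = g ^+ 2 * (P * Q).
  rewrite -eg /T /P /Q !cabsM cabs_conj.
  transitivity (r0 * cabs c0 * r0 * cabs c0 * cabs c1 ^+ 2 * cabs u0 ^+ 2 * cabs u2 ^+ 2).
    by ring.
  rewrite -e0; transitivity ((r1 * cabs c1) * cabs c1 * cabs b0 * r0 * cabs c0 *
    cabs u0 ^+ 2 * cabs u2 ^+ 2); first by ring.
  by rewrite -e1; ring.
have PQ0 : 0 <= g * (P + Q) by apply: mulr_ge0 => //; exact: addr_ge0.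
have T20 : 0 <= 2 * T by exact: mulr_ge0.
rewrite -(@ler_pXn2r _ 2) ?nnegrE //.
rewrite exprMn TT [leRHS]exprMn mulrCA ler_wpM2l ?sqr_ge0 //.
by have := sqr_ge0 (P - Q); lra.
Qed.

Section CoreBound.
Variables (R : realType) (m N : nat).
Hypotheses (hN : N = (4 * m + 2)%N) (m_gt0 : (0 < m)%N).
Variable d : R.
Hypotheses (d_gt0 : 0 < d) (d_le : d <= pi / N%:R).

Local Notation e := (link_cos N d).
Local Notation c := (link_up N d).
Local Notation b := (link_down N d).
Local Notation q := (pi / N%:R : R).

Let N_gt0 : (0 < N)%N. Proof. by rewrite hN addn2. Qed.
Let q_gt0 : 0 < q. Proof. by rewrite divr_gt0 ?pi_gt0 ?ltr0n. Qed.
Let piE : pi = 4 * (m%:R * q) + 2 * q.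
Proof.
have -> : 4 * (m%:R * q) + 2 * q = (4 * m + 2)%:R * q by rewrite natrD natrM; ring.
by rewrite -hN mulrC divfK // pnatr_eq0 -lt0n.
Qed.
Let angleE k : q * (2 * k + 1)%:R - d = 2 * (k%:R * q) + q - d.
Proof. by rewrite natrD natrM; ring. Qed.
Let scale_le (i j : nat) : (i <= j)%N -> (i%:R * q <= j%:R * q).
Proof. by move=> ij; rewrite ler_pM2r // ler_nat. Qed.

Let scaleS (i : nat) : i.+1%:R * q = i%:R * q + q.
Proof. by rewrite mulrSr mulrDl mul1r. Qed.
Let scale3 : (3 * m + 1)%:R * q = 3 * (m%:R * q) + q.
Proof. by rewrite natrD natrM; ring. Qed.

(** The signs are plus up to [m], minus up to [3 * m + 1], then plus again. The angle at [m] is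
    [pi / 2 - d], so [d > 0] makes the sign strict. *)
Lemma link_cos_gt0 k : (k <= m)%N -> 0 < e k.
Proof.
move=> /scale_le km; rewrite /link_cos angleE; apply: cos_gt0_pihalf.
have k0 : 0 <= k%:R * q by rewrite mulr_ge0 ?ler0n ?ltW.
move: piE q_gt0 d_gt0 d_le k0 km; move: (k%:R * q) (m%:R * q) (q) => K M Q *.
by apply/andP; split; lra.
Qed.

Lemma link_cos_lt0 k : (m < k)%N -> (k <= 3 * m + 1)%N -> e k < 0.
Proof.
move=> /scale_le; rewrite scaleS => k1 /scale_le; rewrite scale3 => k2.
rewrite /link_cos angleE -[X in cos X](subrK pi) cosDpi oppr_lt0.
apply: cos_gt0_pihalf; move: piE q_gt0 d_gt0 d_le k1 k2.
move: (k%:R * q) (m%:R * q) (q) => K M Q *; apply/andP; split; lra.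
Qed.

Lemma link_cos_gt0_wrap k : (3 * m + 1 < k)%N -> (k <= N)%N -> 0 < e k.
Proof.
move=> /scale_le; rewrite scaleS scale3 => k1 /scale_le.
have -> : N%:R * q = pi by rewrite mulrC divfK // pnatr_eq0 -lt0n.
move=> k2.
rewrite /link_cos angleE -[X in cos X](subrK (pi *+ 2)) cosD2pi -mulr_natl.
apply: cos_gt0_pihalf; move: piE q_gt0 d_gt0 d_le k1 k2.
move: (k%:R * q) (m%:R * q) (q) => K M Q *; apply/andP; split; lra.
Qed.

Lemma link_cos_m : e m = sin d.
Proof.
rewrite /link_cos angleE -[RHS]cosBpihalf -[RHS]cosN; congr cos.
by move: piE; move: (m%:R * q) (q) => M Q ->; field.
Qed.

Lemma link_cos_mS : e m.+1 = - sin (2 * q - d).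
Proof.
rewrite /link_cos angleE -cosDpihalf scaleS; congr cos.
by move: piE; move: (m%:R * q) (q) => M Q ->; field.
Qed.

Lemma link_cos_3m : e (3 * m + 1) = - sin d.
Proof.
rewrite -link_cos_m /link_cos !angleE -cosDpi scale3; congr cos.
by move: piE; move: (m%:R * q) (q) => M Q ->; ring.
Qed.

Lemma link_cos_3mS : e (3 * m + 2) = sin (2 * q - d).
Proof.
rewrite -[RHS]opprK -link_cos_mS /link_cos !angleE -cosDpi addnS !scaleS scale3.
by congr cos; move: piE; move: (m%:R * q) (q) => M Q ->; ring.
Qed.

Lemma link_cos_neq0 k : (k <= N)%N -> e k != 0.
Proof.
move=> kN; have [km|mk] := leqP k m; first by rewrite gt_eqF // link_cos_gt0.
have [k3|k3] := leqP k (3 * m + 1); first by rewrite lt_eqF // link_cos_lt0.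
by rewrite gt_eqF // link_cos_gt0_wrap.
Qed.

Lemma cabs_link_mul k : cabs (c k * b k) = `|e k| / 2.
Proof.
rewrite link_mul.
have -> : 'i / 2 * (e k)%:C = 'i * (e k / 2)%:C.
  by rewrite rmorphM fmorphV rmorph_nat /=; ring.
rewrite cabsM cabs_real normrM [`|2^-1|]ger0_norm ?invr_ge0 ?ler0n //.
by rewrite cabsE /= expr0n expr1n add0r sqrtr1 mul1r.
Qed.

Lemma link_neq0 k : (c k != 0) && (b k != 0).
Proof.
elim/ltn_ind: k => k IHk; have [kN|Nk] := leqP k N.
  have := link_cos_neq0 kN; rewrite -normr_gt0 => ek.
  have : cabs (c k * b k) != 0 by rewrite cabs_link_mul gt_eqF ?divr_gt0.
  by rewrite cabs_eq0 mulf_eq0 negb_or.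
rewrite -(subnK (ltnW Nk)) (link_up_periodic hN) (link_down_periodic hN).
by apply: IHk; rewrite ltn_subrL N_gt0 (leq_trans _ Nk).
Qed.

(** An explicit solution of [weight_rec]: moving the half-period window by one step drops [|b k|]
    and gains [|b (k + 2 m + 1)| = |c k|]. Being built from periodic links, it closes up around the
    cycle. *)
Definition weight k : R := \prod_(i < 2 * m + 1) cabs (b (k + i)).

Lemma weight_gt0 k : 0 < weight k.
Proof.
apply: prodr_gt0 => i _; rewrite lt_def cabs_ge0 cabs_eq0 andbT.
by have /andP[] := link_neq0 (k + i).
Qed.

Lemma weight_periodic k : weight (k + N) = weight k.
Proof.
by apply: eq_bigr => i _; rewrite addnAC (link_down_periodic hN).
Qed.

Lemma weight_rec k : weight k.+1 * cabs (b k) = weight k * cabs (c k).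
Proof.
have h1 : \prod_(i < (2 * m + 1).+1) cabs (b (k + i)) = weight k * cabs (c k).
  by rewrite big_ord_recr /= addnA (link_down_half hN) cabs_conj.
rewrite -h1 big_ord_recl addn0 mulrC; congr (_ * _).
by apply: eq_bigr => i _; rewrite lift0 addSnnS.
Qed.

(** The moduli agree by [weight_rec]; multiplying by [c k] compares the phases, as [c k * b k] is
    ['i / 2] times the real [e k]. *)
Lemma weight_rel k : (k <= N)%N ->
  (weight k.+1)%:C * b k = 'i * (Num.sg (e k) * weight k)%:C * (c k)^*.
Proof.
move=> kN; have /andP[c0 b0] := link_neq0 k.
apply: (mulIf c0).
have -> : (weight k.+1)%:C * b k * c k = (weight k.+1)%:C * (c k * b k) by ring.
rewrite link_mul.
have -> : 'i * (Num.sg (e k) * weight k)%:C * (c k)^* * c k =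
    'i * (Num.sg (e k) * weight k * cabs (c k) ^+ 2)%:C.
  by rewrite [in RHS]rmorphM /= -mulc_conj; ring.
have -> : (weight k.+1)%:C * ('i / 2 * (e k)%:C) = 'i * (weight k.+1 * (e k / 2))%:C.
  by rewrite rmorphM rmorphM fmorphV rmorph_nat /=; ring.
congr (_ * _%:C).
have := cabs_link_mul k; rewrite cabsM => eb.
rewrite [in LHS](numEsg (e k)) -[_ * _ / 2]mulrA -eb.
transitivity (Num.sg (e k) * (weight k.+1 * cabs (b k)) * cabs (c k)); first by ring.
by rewrite weight_rec; ring.
Qed.

(* Here [4m + 2] matters: the two sign changes of [link_cos] are antipodal and,
   as [m > 0], the corresponding two hops have four distinct endpoints. *)
Lemma Re_sqr_eigen_le z : detA N d z = 0 ->
  `|complex.Re (z ^+ 2)| <= gamma_at N d.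
Proof.
move=> /specE /eigenvalueP [v v_eig v0].
pose u := chirp_transform v.
have uN k : u (k + N)%N = u k := chirp_transform_periodic hN v k.
pose s k := Num.sg (e k).
pose Y k := weight k * complex.Re (c k * c k.+1 * (u k)^* * u k.+2).
pose G k := weight k * cabs (u k) ^+ 2.
have G0 k : 0 <= G k by apply: mulr_ge0; [exact/ltW/weight_gt0 | exact: sqr_ge0].
have sum_eq : complex.Re (z ^+ 2) * \sum_(k < N) G k =
    \sum_(k < N) (1 - s k * s k.+1) * Y k.
  apply: weighted_re_sum => //.
  - exact: (link_up_periodic hN d).
  - by move=> k; rewrite weight_periodic.
  - exact: (chirp_transform_rec hN v_eig).
  - exact: weight_rel.
  - move=> k; rewrite link_mul.
    have -> : 'i / 2 * (e k)%:C = 'i * (e k / 2)%:C.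
      by rewrite rmorphM fmorphV rmorph_nat /=; ring.
    by rewrite /=; ring.
have g0 : 0 <= gamma_at N d by rewrite mulr_ge0 ?invr_ge0 ?sqrtr_ge0.
have sd : 0 < sin d by rewrite -link_cos_m link_cos_gt0.
have sq : 0 < sin (2 * q - d).
  by rewrite -oppr_lt0 -link_cos_mS link_cos_lt0 //; clear -m_gt0; lia.
have gE : gamma_at N d ^+ 2 = sin d / 2 * (sin (2 * q - d) / 2).
  rewrite /gamma_at exprMn sqr_sqrtr; last by rewrite -[2 * pi / N%:R]mulrA ltW // mulr_gt0.
  by rewrite -[2 * pi / N%:R]mulrA; field.
have hop k : `|e k| * `|e k.+1| = sin d * sin (2 * q - d) ->
    2 * `|Y k| <= gamma_at N d * (G k + G k.+2).
  move=> ek; apply: (@hop_le _ _ (weight k.+1) _ _ _ _ (b k) (b k.+1)) => //.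
  - exact/ltW/weight_gt0.
  - exact/ltW/weight_gt0.
  - exact: weight_rec.
  - exact: weight_rec.
  by rewrite !cabs_link_mul gE mulrACA ek mulrACA.
have Ym : 2 * `|Y m| <= gamma_at N d * (G m + G m.+2).
  by apply: hop; rewrite link_cos_m link_cos_mS normrN !gtr0_norm.
have Y3m : 2 * `|Y (3 * m + 1)%N| <= gamma_at N d * (G (3 * m + 1)%N + G (3 * m + 1).+2).
  apply: hop; rewrite link_cos_3m -addnS link_cos_3mS normrN !gtr0_norm //.
have hm : (m < N)%N by clear -hN m_gt0; lia.
have h3m : (3 * m + 1 < N)%N by clear -hN m_gt0; lia.
(* The factor [1 - s k * s k.+1] is 2 at the two sign changes and 0 elsewhere. *)
have sum2 : \sum_(k < N) (1 - s k * s k.+1) * Y k = 2 * Y m + 2 * Y (3 * m + 1)%N.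
  rewrite (bigD1 (Ordinal hm)) // (bigD1 (Ordinal h3m)) /=; last first.
    by rewrite -val_eqE /=; clear -hN m_gt0; lia.
  rewrite big1 => [|k /andP[km k3]].
    rewrite /s link_cos_m link_cos_mS link_cos_3m -addnS link_cos_3mS.
    by rewrite !sgrN !gtr0_sg //; ring.
  rewrite -!val_eqE /= in km k3; have kN := ltn_ord k.
  suff -> : s k * s k.+1 = 1 by rewrite subrr mul0r.
  rewrite /s; have [k1|k1] := ltnP k m.
    by rewrite !gtr0_sg ?mul1r // link_cos_gt0 // ltnW.
  have [k2|k2] := ltnP k (3 * m + 1).
    rewrite !ltr0_sg ?mulrNN ?mulr1 // link_cos_lt0 //; clear -hN m_gt0 kN km k3 k1 k2; lia.
  by rewrite !gtr0_sg ?mul1r // link_cos_gt0_wrap //; clear -hN m_gt0 kN km k3 k1 k2; lia.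
have four : G m + G m.+2 + (G (3 * m + 1)%N + G (3 * m + 1).+2) <= \sum_(k < N) G k.
  have GN : G N = G 0%N by rewrite /G -[N]add0n uN weight_periodic.
  (* The indices are moved to 1, ..., [N], since the endpoint [3 * m + 3] equals [N] when [m = 1];
     the ordinals below are the predecessors of the four endpoints. *)
  rewrite -(sum_shift_periodic GN).
  have h1 : (m.-1 < N)%N by clear -hN m_gt0; lia.
  have h2 : (m.+1 < N)%N by clear -hN m_gt0; lia.
  have h3 : (3 * m < N)%N by clear -hN m_gt0; lia.
  have h4 : ((3 * m + 1).+1 < N)%N by clear -hN m_gt0; lia.
  rewrite (bigD1 (Ordinal h1)) // (bigD1 (Ordinal h2)) /=; last by rewrite -val_eqE /=; clear -hN m_gt0; lia.
  rewrite (bigD1 (Ordinal h3)) /=; last by rewrite -!val_eqE /=; clear -hN m_gt0; lia.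
  rewrite (bigD1 (Ordinal h4)) /=; last by rewrite -!val_eqE /=; clear -hN m_gt0; lia.
  set rest := \sum_(i < N | _) _.
  have rest0 : 0 <= rest by apply: sumr_ge0 => k _; exact: G0.
  by rewrite prednK // addn1 !addrA lerDl.
have S0 : 0 < \sum_(k < N) G k.
  have [k uk] := chirp_transform_neq0 hN v0.
  rewrite (bigD1 k) //= ltr_wpDr ?sumr_ge0 //.
  by rewrite mulr_gt0 ?weight_gt0 // exprn_gt0 // lt_def cabs_ge0 cabs_eq0 uk.
rewrite -(ler_pM2r S0) -[X in `|_| * X](gtr0_norm S0) -normrM sum_eq sum2.
have norm2 (x : R) : `|2 * x| = 2 * `|x| by rewrite normrM ger0_norm.
apply: le_trans (ler_normD _ _) _; rewrite !norm2.
apply: le_trans (lerD Ym Y3m) _; rewrite -mulrDr.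
exact: ler_wpM2l.
Qed.

End CoreBound.

(** * The limit of vanishing [d] *)

Import numFieldNormedType.Exports.

Section Limit.
Variables (R : realType) (m N : nat).
Hypotheses (hN : N = (4 * m + 2)%N) (m_gt0 : (0 < m)%N).

Let N_gt0 : (0 < N)%N. Proof. by rewrite hN addn2. Qed.
Let N_even : ~~ odd N. Proof. by rewrite hN oddD oddM. Qed.

Lemma detA_factor (theta : R) : exists r : seq R[i], size r = N /\
  forall z, detA N theta z = \prod_(x <- r) (z - x).
Proof.
have [r rE] := closed_field_poly_normal (char_poly (A_mx N (pi / 2) theta)).
rewrite (monicP (char_poly_monic _)) scale1r in rE.
exists r; split.
  by have := size_char_poly (A_mx N (pi / 2) theta); rewrite rE size_prod_XsubC => -[].
move=> z; rewrite /detA -horner_char_poly rE horner_prod.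
by apply: eq_bigr => x _; rewrite !hornerE.
Qed.

(* If [z] is an eigenvalue at angle 0 with [e = |Re z^2| > 0], then at a nearby
   angle [d] all eigenvalues [x] satisfy [|x^2 - z^2| >= e / 2], whereas
   [prod (z^2 - x^2)] is the square of a quantity tending to 0 with [d]. *)
Lemma Re_sqr_eigen0 (z : R[i]) : detA N 0 z = 0 -> complex.Re (z ^+ 2) = 0.
Proof.
move=> dz; apply/eqP; apply: contraT => Rez.
pose e := `|complex.Re (z ^+ 2)|; have e0 : 0 < e by rewrite normr_gt0.
(* Two quarter turns send [z] to [- z]. *)
have dNz : detA N 0 (- z) = 0.
  move: dz; rewrite (detA0_rot N_even N_gt0 z hN) (detA0_rot N_even N_gt0 _ hN) opprK.
  by rewrite mulrA mulrNN -expr2 sqr_i mulN1r.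
(* The bound 1 gives [del ^+ 2 <= del]; the other contradicts the lower bound [lb]. *)
pose eps := Num.min 1 ((e / 2) ^+ N).
have eps0 : 0 < eps by rewrite lt_min ltr01 exprn_gt0 // divr_gt0.
have q0 : 0 < pi / N%:R :> R by rewrite divr_gt0 ?pi_gt0 ?ltr0n.
have [d /= [[sd cd] [d0 dq]]] : exists d : R,
    (sin d < e ^+ 2 /\ 1 - cos (N%:R * d) < eps) /\ (0 < d /\ d <= pi / N%:R).
  apply: (@filter_ex _ (at_right (0 : R))).
  near=> d; split; split.
  - near: d; apply: (@cvgr_lt _ _ _ _ sin (sin 0)); last by rewrite sin0 exprn_gt0.
    by apply: cvg_at_right_filter; exact: continuous_sin.
  - near: d; apply: (@cvgr_lt _ _ _ _ (fun d => 1 - cos (N%:R * d)) (1 - cos (N%:R * 0))).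
      apply/cvg_at_right_filter; apply: cvgB; first exact: cvg_cst.
      apply: (@continuous_comp _ _ _ (fun d : R => N%:R * d) cos); last exact: continuous_cos.
      exact: mulrl_continuous.
    by rewrite mulr0 cos0 subrr.
  - by near: d; exact: nbhs_right_gt.
  - by near: d; exact: nbhs_right_le.
have ge : gamma_at N d <= e / 2.
  rewrite /gamma_at mulrC ler_pM2r ?invr_gt0 // -[leRHS]gtr0_norm // -sqrtr_sqr ler_wsqrtr //.
  have s0 : 0 <= sin d.
    apply: sin_ge0_pi; rewrite ltW //= (le_trans dq) // ler_pdivrMr ?ltr0n //.
    by rewrite ler_peMr ?pi_ge0 // ler1n.
  apply: le_trans (ltW sd); rewrite -[leRHS]mulr1 ler_wpM2l //; exact: sin_le1.
(* The value of the determinant at angle [d] at both [z] and [- z]. *)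
pose del : R := 2 ^ (1 - N%:Z) * (1 - cos (N%:R * d)).
have del0 : 0 <= del by rewrite mulr_ge0 ?exprz_ge0 // subr_ge0 cos_le1.
have del1 : del < eps.
  apply: le_lt_trans cd; rewrite ler_piMl ?subr_ge0 ?cos_le1 //.
  rewrite -(subnKC N_gt0) PoszD opprD addrA subrr add0r -exprnN invf_le1 ?exprn_gt0 //.
  by rewrite exprn_ege1 // ler1n.
have [r [sr rE]] := detA_factor d.
have lb : (e / 2) ^+ N <= cabs (\prod_(x <- r) ((z - x) * (- z - x))).
  (* The induction runs over lists contained in [r], so that each entry remains known to be an
     eigenvalue at angle [d]. *)
  rewrite -sr; have : {subset r <= r} by [].
  elim: {1 3 4}r => [|x s IHs] sr'; first by rewrite big_nil expr0 cabs_real normr1.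
  rewrite big_cons cabsM exprS; apply: ler_pM; rewrite ?exprn_ge0 ?divr_ge0 ?(ltW e0) //.
    have xr : x \in r by apply: sr'; rewrite inE eqxx.
    have : `|complex.Re (x ^+ 2)| <= gamma_at N d.
      apply: (Re_sqr_eigen_le hN m_gt0 d0 dq).
      by rewrite rE (big_rem x) //= subrr mul0r.
    have -> : (z - x) * (- z - x) = x ^+ 2 - z ^+ 2 by ring.
    move=> hx; apply: le_trans (normRe_le_cabs _).
    have -> : complex.Re (x ^+ 2 - z ^+ 2) = complex.Re (x ^+ 2) - complex.Re (z ^+ 2).
      by case: (x ^+ 2) (z ^+ 2) => [? ?] [? ?].
    have := lerB_dist (complex.Re (z ^+ 2)) (complex.Re (x ^+ 2)).
    rewrite -/e distrC; lra.
  by apply: IHs => y ys; apply: sr'; rewrite inE ys orbT.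
have : (e / 2) ^+ N <= del ^+ 2.
  apply: le_trans lb _; rewrite big_split -!rE /= (detA_theta N_even N_gt0 d z).
  rewrite (detA_theta N_even N_gt0 d (- z)) dz dNz !add0r.
  by rewrite cabsM cabs_real ger0_norm.
rewrite leNgt; apply: contraNT => _.
have : del ^+ 2 <= del.
  by rewrite expr2 ler_piMl // (le_trans (ltW del1)) // ge_min lexx.
move=> /le_lt_trans; apply; apply: lt_le_trans del1 _.
by rewrite ge_min lexx orbT.
Unshelve. all: by end_near.
Qed.

End Limit.

(** The angle is replaced by [dN N theta]; a positive value falls under the weighted bound, the
    value 0 under the limit argument. *)
Lemma Re_sqr_spec_le (R : realType) (m N : nat) (theta : R) (z : R[i]) :
  N = (4 * m + 2)%N -> (0 < m)%N -> spec (A_mx N (pi / 2) theta) z ->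
  `|complex.Re (z ^+ 2)| <= gammaN N theta.
Proof.
move=> hN m0 /specE dz.
have N_gt0 : (0 < N)%N by rewrite hN addn2.
have N_even : ~~ odd N by rewrite hN oddD oddM.
have /andP[d0 dq] := dN_itv N_gt0 theta.
have {}dz : detA N (dN N theta) z = 0.
  by rewrite detA_theta // cos_dN // -detA_theta.
rewrite -[gammaN _ _]/(gamma_at N (dN N theta)).
have [dN0|dN0] := eqVneq (dN N theta) 0; last first.
  by apply: (Re_sqr_eigen_le hN) => //; rewrite lt_def dN0.
rewrite dN0 in dz *; rewrite (Re_sqr_eigen0 hN m0 dz) normr0.
by rewrite mulr_ge0 ?invr_ge0 ?sqrtr_ge0.
Qed.

Theorem corollary3p6 (R : realType) (m N : nat)
    (hN : N = (4 * m + 2)%N) (hN6 : (6 <= N)%N) (theta : R) :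
  [/\ 0 <= dN N theta <= pi / N%:R,
      (forall z : R[i], spec (A_mx N (pi / 2) theta) z ->
        [/\ `|complex.Re (z ^+ 2)| <= gammaN N theta
              <= 2^-1 * sin (pi / N%:R),
            cdist z (cross_pi4 R) <= Num.sqrt (gammaN N theta / 2)
              <= 2^-1 * Num.sqrt (sin (pi / N%:R))
          & z != 0 ->
            cdist z (cross_pi4 R) <= gammaN N theta / (Num.sqrt 2 * cabs z)
              <= sin (pi / N%:R) / (2 * Num.sqrt 2 * cabs z)]),
      (lattice R N theta ->
        spec (A_mx N (pi / 2) theta) `<=` cross_pi4 R),
      (~ lattice R N theta ->
        spec (A_mx N (pi / 2) theta) `&` cross_pi4 R = set0)
    & forall tau : 'I_m -> R,
        (forall r, 0 < tau r) ->
        (forall z : R[i], \det (z%:M - A_mx N (pi / 2) 0) =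
           z ^+ 2 * \prod_(r < m) (z ^+ 4 + (tau r)%:C)) ->
        forall z : R[i], \det (z%:M - A_mx N (pi / 2) theta) =
          z ^+ 2 * \prod_(r < m) (z ^+ 4 + (tau r)%:C)
          + (2 ^ (1 - N%:Z) * (1 - cos (N%:R * theta)))%:C].
Proof.
have m_gt0 : (0 < m)%N by clear -hN hN6; lia.
have N_gt0 : (0 < N)%N by rewrite hN addn2.
have N_gt1 : (1 < N)%N by rewrite hN addn2.
have N_even : ~~ odd N by rewrite hN oddD oddM.
have hg z := @Re_sqr_spec_le R m N theta z hN m_gt0.
have g_le : gammaN N theta <= 2^-1 * sin (pi / N%:R) by exact: gamma_at_le.
split.
- exact: dN_itv.
- move=> z /hg hz; have [h1 h2] := cdist_cross hz.
  split; first by rewrite hz.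
  + rewrite h1 /=.
    have -> : 2^-1 * Num.sqrt (sin (pi / N%:R)) =
        Num.sqrt (2^-1 ^+ 2 * sin (pi / N%:R)) :> R.
      by rewrite sqrtrM ?sqr_ge0 // sqrtr_sqr ger0_norm.
    rewrite ler_wsqrtr //.
    by move: g_le; move: (gammaN N theta) (sin _) => g s; lra.
  + move=> z0.
    have s0 : 0 < Num.sqrt 2 * cabs z.
      by rewrite mulr_gt0 ?sqrtr_gt0 // lt_def cabs_ge0 cabs_eq0 z0.
    rewrite ler_pdivlMr // h2 /=.
    have -> : sin (pi / N%:R) / (2 * Num.sqrt 2 * cabs z) =
              2^-1 * sin (pi / N%:R) / (Num.sqrt 2 * cabs z).
      by rewrite -mulrA invfM [in RHS]mulrC mulrA [RHS]mulrC; ring.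
    by rewrite ler_pM2r ?invr_gt0.
- move=> /(dN_eq0 N_gt0) d0 z /hg; rewrite /gammaN d0 sin0 mul0r sqrtr0 mulr0.
  by rewrite normr_le0 => /eqP /crossP.
- move=> nL; apply/seteqP; split=> // z [/specE dz zX]; apply: nL.
  by apply: cos_eq1_lattice => //; exact: (detA_cross N_even N_gt0 hN zX dz).
- move=> tau _ h z; rewrite -h; exact: detA_theta.
Qed.
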